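(* The vector space $H^1_{\varrho_0}(\Gamma_{22},\mathbb R^{1,3})$ has dimension one.
   Context: $\mathbb R^{1,3}$ is $\mathbb R^4$ with the Minkowski form $-x_0^2+x_1^2+x_2^2+x_3^2$ and standard basis $e_0,\dots,e_3$; for a unit spacelike vector $v$, $r_v\in\mathrm O(1,3)$ is the reflection equal to $-1$ on $v$ and to the identity on $v^\perp$. $\Gamma_{22}$ is the right-angled Coxeter group with $22$ generators $p_\varepsilon,m_\varepsilon$ ($\varepsilon=(\varepsilon_1,\varepsilon_2,\varepsilon_3)\in\{\pm1\}^3$), $\ell_{k,s}$ ($k\in\{1,2,3\}$, $s\in\{\pm1\}$), each of order two, with commutation relations: $p_\varepsilon$ and $m_\delta$ commute whenever $\varepsilon,\delta$ differ in at most one coordinate; $p_\varepsilon$ and $m_\varepsilon$ commute with $\ell_{k,s}$ whenever $\varepsilon_k=s$. $\varrho_0:\Gamma_{22}\to\mathrm O(1,3)$ is the representation with $\varrho_0(p_\varepsilon)=-\mathrm{id}$, $\varrho_0(m_\varepsilon)=r_{v_\varepsilon}$ where $v_\varepsilon=(\sqrt2,\varepsilon_1,\varepsilon_2,\varepsilon_3)$, and $\varrho_0(\ell_{k,s})=r_{v_{k,s}}$ where $v_{k,s}=e_0+s\sqrt2e_k$. $H^1_{\varrho}(\Gamma,V)=Z^1_\varrho(\Gamma,V)/B^1_\varrho(\Gamma,V)$ is the usual first group cohomology: cocycles are maps $\tau:\Gamma\to V$ with $\tau(\gamma\eta)=\varrho(\gamma)\tau(\eta)+\tau(\gamma)$;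 coboundaries are maps $\gamma\mapsto\varrho(\gamma)v-v$ with $v\in V$. *)

(* Defs.v *)
From HB Require Import structures.
From mathcomp Require Import all_boot all_order all_algebra.
From mathcomp Require Import all_classical all_reals.
From mathcomp Require Import ring.

Set Implicit Arguments.
Unset Strict Implicit.
Unset Printing Implicit Defensive.
Import Order.TTheory GRing.Theory Num.Theory.
Local Open Scope ring_scope.
Local Open Scope quotient_scope.

(** * Right-angled Coxeter groups

  The group <S | s^2 = 1, st = ts whenever com s t>, as the quotient of the
  words in S by the congruence generated by the relations. Unsigned words are
  enough, since every generator is its own inverse; the inverse of a word is
  its reversal. *)

Section RACG.
Variables (S : choiceType) (com : rel S).

Inductive racg_rel : seq S -> seq S -> Prop :=
| racg_sq u v s : racg_rel (u ++ [:: s; s] ++ v) (u ++ v)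
| racg_com u v s t : com s t ->
    racg_rel (u ++ [:: s; t] ++ v) (u ++ [:: t; s] ++ v)
| racg_refl w : racg_rel w w
| racg_sym w1 w2 : racg_rel w1 w2 -> racg_rel w2 w1
| racg_trans w1 w2 w3 : racg_rel w1 w2 -> racg_rel w2 w3 -> racg_rel w1 w3.

Definition racg_eqv : rel (seq S) := fun w1 w2 => `[< racg_rel w1 w2 >].

Lemma racg_eqv_equiv : equiv_class_of racg_eqv.
Proof.
split=> [w|w1 w2|w2 w1 w3].
- exact/asboolP/racg_refl.
- by apply/asboolP/asboolP; exact: racg_sym.
- by move=> /asboolP h1 /asboolP h2; apply/asboolP/(racg_trans h1).
Qed.

Canonical racg_eqv_rel := EquivRelPack racg_eqv_equiv.
Canonical racg_encModRel := defaultEncModRel racg_eqv.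

Definition racg := {eq_quot racg_eqv}.
HB.instance Definition _ : EqQuotient _ racg_eqv racg := EqQuotient.on racg.
HB.instance Definition _ := Choice.on racg.

Lemma racg_piP w1 w2 : reflect (racg_rel w1 w2) (\pi_racg w1 == \pi_racg w2).
Proof. by rewrite piE; exact: asboolP. Qed.

Lemma racg_pi w1 w2 : racg_rel w1 w2 -> \pi_racg w1 = \pi_racg w2.
Proof. by move=> h; apply/eqP/racg_piP. Qed.

Lemma racg_repr w : racg_rel (repr (\pi_racg w)) w.
Proof. by apply/racg_piP; rewrite reprK. Qed.

Lemma racg_rel_catl u w1 w2 : racg_rel w1 w2 -> racg_rel (u ++ w1) (u ++ w2).
Proof.
elim=> {w1 w2} [v w s|v w s t st|w|w1 w2 _ h|w1 w2 w3 _ h1 _ h2].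
- by rewrite !catA -(catA (u ++ v)); exact: racg_sq.
- by rewrite !(catA u) !(catA (u ++ v)) -!(catA (u ++ v)); exact: racg_com.
- exact: racg_refl.
- exact: racg_sym.
- exact: racg_trans h1 h2.
Qed.

Lemma racg_rel_catr u w1 w2 : racg_rel w1 w2 -> racg_rel (w1 ++ u) (w2 ++ u).
Proof.
elim=> {w1 w2} [v w s|v w s t st|w|w1 w2 _ h|w1 w2 w3 _ h1 _ h2].
- by rewrite -!catA; exact: racg_sq.
- by rewrite -!catA; exact: racg_com.
- exact: racg_refl.
- exact: racg_sym.
- exact: racg_trans h1 h2.
Qed.

Lemma racg_rel_rev w1 w2 : racg_rel w1 w2 -> racg_rel (rev w1) (rev w2).
Proof.
elim=> {w1 w2} [v w s|v w s t st|w|w1 w2 _ h|w1 w2 w3 _ h1 _ h2].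
- by rewrite !rev_cat -catA; exact: racg_sq.
- by rewrite !rev_cat -!catA; apply: racg_sym; exact: racg_com.
- exact: racg_refl.
- exact: racg_sym.
- exact: racg_trans h1 h2.
Qed.

Lemma racg_rel_revK w : racg_rel (rev w ++ w) [::].
Proof.
elim: w => [|s w ih]; first exact: racg_refl.
rewrite rev_cons cat_rcons.
by apply: racg_trans ih; exact: (racg_sq (rev w) w s).
Qed.

Definition racg_one : racg := \pi_racg [::].
Definition racg_mul (x y : racg) : racg := \pi_racg (repr x ++ repr y).
Definition racg_inv (x : racg) : racg := \pi_racg (rev (repr x)).

Lemma racg_piM w1 w2 :
  racg_mul (\pi_racg w1) (\pi_racg w2) = \pi_racg (w1 ++ w2).
Proof.
apply: racg_pi; apply: racg_trans (racg_rel_catl _ (racg_repr w2)).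
exact: racg_rel_catr (racg_repr w1).
Qed.

Lemma racg_mulA : associative racg_mul.
Proof.
elim/quotW=> u; elim/quotW=> v; elim/quotW=> w.
by rewrite (racg_piM v w) (racg_piM u v) !racg_piM catA.
Qed.

Lemma racg_mul1 : left_id racg_one racg_mul.
Proof. by elim/quotW=> w; rewrite racg_piM. Qed.

Lemma racg_mulr1 : right_id racg_one racg_mul.
Proof. by elim/quotW=> w; rewrite racg_piM cats0. Qed.

Lemma racg_mulV : left_inverse racg_one racg_inv racg_mul.
Proof.
move=> x; rewrite -{2}[x]reprK racg_piM.
by apply: racg_pi; exact: racg_rel_revK.
Qed.

Lemma racg_mulrV : right_inverse racg_one racg_inv racg_mul.
Proof.
move=> x; rewrite -{1}[x]reprK racg_piM.
by apply: racg_pi; rewrite -{1}[repr x]revK; exact: racg_rel_revK.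
Qed.

HB.instance Definition _ := isGroup.Build racg
  racg_mulA racg_mul1 racg_mulr1 racg_mulV racg_mulrV.

Definition racg_gen (s : S) : racg := \pi_racg [:: s].

Lemma racg_gen_sq s : (racg_gen s * racg_gen s = 1)%g.
Proof.
by rewrite [LHS]racg_piM; apply: racg_pi; exact: (racg_sq [::] [::] s).
Qed.

Lemma racg_gen_com s t : com s t ->
  (racg_gen s * racg_gen t = racg_gen t * racg_gen s)%g.
Proof.
move=> st; rewrite [LHS]racg_piM [RHS]racg_piM; apply: racg_pi.
exact: (racg_com [::] [::] st).
Qed.

Lemma racg_ind (P : racg -> Prop) : P 1%g ->
  (forall s x, P x -> P (racg_gen s * x)%g) -> forall x, P x.
Proof.
move=> P1 PM x; rewrite -[x]reprK; elim: (repr x) => [|s w ih] //.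
by rewrite -cat1s -racg_piM; exact: PM.
Qed.

(** The universal property: a map on the generators that satisfies the
  relations extends uniquely to a group morphism. The extension is computed on
  a representative word. *)
Section Lift.
Variables (H : groupType) (f : S -> H).

Definition word_eval (w : seq S) : H := foldr (fun s x => f s * x)%g 1%g w.

Lemma word_eval_cat w1 w2 :
  word_eval (w1 ++ w2) = (word_eval w1 * word_eval w2)%g.
Proof. by elim: w1 => [|s w ih] /=; rewrite ?mul1g // ih mulgA. Qed.

Definition racg_lift (x : racg) : H := word_eval (repr x).

Hypothesis f_sq : forall s, (f s * f s = 1)%g.
Hypothesis f_com : forall s t, com s t -> (f s * f t = f t * f s)%g.

Lemma word_eval_rel w1 w2 : racg_rel w1 w2 -> word_eval w1 = word_eval w2.
Proof.
elim=> {w1 w2} [v w s|v w s t st|w|w1 w2 _ h|w1 w2 w3 _ h1 _ h2] //.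
- by rewrite !word_eval_cat /= mulg1 f_sq mul1g.
- by rewrite !word_eval_cat /= !mulg1 f_com.
- by rewrite h1.
Qed.

Lemma racg_lift_pi w : racg_lift (\pi_racg w) = word_eval w.
Proof. by apply: word_eval_rel; exact: racg_repr. Qed.

Lemma racg_liftM : {morph racg_lift : x y / (x * y)%g}.
Proof.
move=> x y; rewrite -[x]reprK -[y]reprK [X in racg_lift X]racg_piM.
by rewrite !racg_lift_pi word_eval_cat.
Qed.

Lemma racg_lift1 : racg_lift 1%g = 1%g.
Proof. exact: (racg_lift_pi [::]). Qed.

Lemma racg_lift_gen s : racg_lift (racg_gen s) = f s.
Proof. by rewrite racg_lift_pi /= mulg1. Qed.

Lemma racg_lift_uniq (g : {multiplicative racg -> H}) :
  (forall s, g (racg_gen s) = f s) -> g =1 racg_lift.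
Proof.
have g1 : g 1%g = 1%g.
  by apply: (mulgI (g 1%g)); rewrite -gmulfM !mulg1.
move=> gf; elim/racg_ind=> [|s x ih]; first by rewrite g1 racg_lift1.
by rewrite gmulfM gf ih racg_liftM racg_lift_gen.
Qed.

End Lift.
End RACG.

(** * First group cohomology *)

Section Cohomology.
Variables (F : fieldType) (G : groupType) (n : nat) (rho : G -> 'M[F]_n).

Definition is_cocycle : {pred G -> 'cV[F]_n} :=
  fun tau => `[< forall g h, tau (g * h)%g = rho g *m tau h + tau g >].

Lemma is_cocycle_submod : subsemimod_closed is_cocycle.
Proof.
split; first split.
- by apply/asboolP=> g h; rewrite mulmx0 addr0.
- move=> t u /asboolP ht /asboolP hu; apply/asboolP=> g h.
  by rewrite !fctE ht hu mulmxDr addrACA.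
- move=> a t /asboolP ht; apply/asboolP=> g h.
  by rewrite !fctE ht scalerDr scalemxAr.
Qed.

HB.instance Definition _ :=
  GRing.isSubmodClosed.Build F (G -> 'cV[F]_n) is_cocycle is_cocycle_submod.

Record Z1 := MkZ1 { Z1_val :> G -> 'cV[F]_n; Z1P : Z1_val \in is_cocycle }.
HB.instance Definition _ := [isSub for Z1_val].
HB.instance Definition _ := [Choice of Z1 by <:].
HB.instance Definition _ := [SubChoice_isSubLmodule of Z1 by <:].

Definition is_coboundary (tau : G -> 'cV[F]_n) :=
  exists v : 'cV[F]_n, forall g, tau g = rho g *m v - v.

Lemma coboundary_cocycle tau :
  (forall g h, rho (g * h)%g = rho g *m rho h) ->
  is_coboundary tau -> tau \in is_cocycle.
Proof.
move=> rhoM [v tauE]; apply/asboolP=> g h; rewrite !tauE rhoM.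
by rewrite mulmxBr mulmxA addrA subrK.
Qed.

Definition B1 : {pred Z1} := fun tau => `[< is_coboundary tau >].

Lemma B1_submod : subsemimod_closed B1.
Proof.
split; first split.
- by apply/asboolP; exists 0 => g; rewrite mulmx0 subrr.
- move=> t u /asboolP[v hv] /asboolP[w hw]; apply/asboolP.
  by exists (v + w) => g; rewrite /= !fctE hv hw mulmxDr opprD addrACA.
- move=> a t /asboolP[v hv]; apply/asboolP.
  by exists (a *: v) => g; rewrite /= !fctE hv scalerBr scalemxAr.
Qed.

HB.instance Definition _ := GRing.isSubmodClosed.Build F Z1 B1 B1_submod.

Definition H1 := {ideal_quot B1}.
HB.instance Definition _ := GRing.Zmodule.on H1.

Lemma H1_eqE (t u : Z1) : (\pi_H1 t == \pi_H1 u) = (t - u \in B1).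
Proof. by rewrite Quotient.idealrBE. Qed.

Definition H1_scale (a : F) (x : H1) : H1 := \pi_H1 (a *: repr x).

Lemma H1_piD (t u : Z1) : \pi_H1 (t + u) = \pi_H1 t + \pi_H1 u.
Proof. exact: raddfD. Qed.

Lemma H1_piZ a (t : Z1) : H1_scale a (\pi_H1 t) = \pi_H1 (a *: t).
Proof.
apply/eqP; rewrite H1_eqE -scalerBr rpredZ //.
by rewrite -H1_eqE reprK.
Qed.

Lemma H1_scaleA a b x : H1_scale a (H1_scale b x) = H1_scale (a * b) x.
Proof.
by elim/quotW: x => t; rewrite (H1_piZ b t) (H1_piZ a) (H1_piZ _ t) scalerA.
Qed.

Lemma H1_scale1 : left_id 1 H1_scale.
Proof. by elim/quotW=> t; rewrite H1_piZ scale1r. Qed.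

Lemma H1_scaleDr : right_distributive H1_scale +%R.
Proof.
move=> a; elim/quotW=> t; elim/quotW=> u.
by rewrite -(H1_piD t u) (H1_piZ a t) (H1_piZ a u) (H1_piZ a (t + u)) scalerDr H1_piD.
Qed.

Lemma H1_scaleDl x : {morph H1_scale^~ x : a b / a + b}.
Proof.
elim/quotW: x => t a b.
by rewrite (H1_piZ a t) (H1_piZ b t) (H1_piZ (a + b) t) scalerDl H1_piD.
Qed.

HB.instance Definition _ := GRing.Zmodule_isLmodule.Build F H1
  H1_scaleA H1_scale1 H1_scaleDr H1_scaleDl.

End Cohomology.

Definition has_dimension (F : fieldType) (V : lmodType F) (n : nat) : Prop :=
  exists b : 'I_n -> V,
    (forall c : 'I_n -> F, \sum_i c i *: b i = 0 -> forall i, c i = 0) /\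
    (forall x, exists c : 'I_n -> F, x = \sum_i c i *: b i).

(** * Minkowski space and its orthogonal group *)

Section Minkowski.
Variable R : realType.

Definition mink_mx : 'M[R]_4 :=
  diag_mx (\row_i (if i == 0 then -1 else 1)).

Definition mink (x y : 'cV[R]_4) : R := (x^T *m mink_mx *m y) 0 0.

Lemma minkE x y : mink x y =
  - (x 0 0 * y 0 0) + \sum_(k < 3) x (lift ord0 k) 0 * y (lift ord0 k) 0.
Proof.
rewrite /mink mul_mx_diag !mxE big_ord_recl !mxE /= mulrN1 mulNr.
by congr (_ + _); apply: eq_bigr => k _; rewrite !mxE /= mulr1.
Qed.

Lemma mink_mx_sq : mink_mx *m mink_mx = 1%:M.
Proof.
rewrite mulmx_diag -diag_const_mx; congr diag_mx; apply/rowP=> i.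
by rewrite !mxE; case: ifP; rewrite ?mulrNN mulr1.
Qed.

Record O13 := MkO13 {
  O13_val :> 'M[R]_4;
  O13P : O13_val^T *m mink_mx *m O13_val == mink_mx
}.
HB.instance Definition _ := [isSub for O13_val].
HB.instance Definition _ := [Choice of O13 by <:].

Lemma O13_mink (A : O13) x y : mink (A *m x) (A *m y) = mink x y.
Proof.
rewrite /mink trmx_mul !mulmxA -!(mulmxA x^T) (eqP (O13P A)).
by rewrite mulmxA.
Qed.

Lemma O13_one_subproof :
  (1%:M : 'M[R]_4)^T *m mink_mx *m 1%:M == mink_mx.
Proof. by rewrite trmx1 mul1mx mulmx1. Qed.

Lemma O13_mul_subproof (A B : O13) :
  (A *m B)^T *m mink_mx *m (A *m B) == mink_mx.
Proof.
by rewrite trmx_mul !mulmxA -!(mulmxA B^T) (eqP (O13P A)) mulmxA (eqP (O13P B)).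
Qed.

Lemma O13_mulVmx (A : O13) : (mink_mx *m A^T *m mink_mx) *m A = 1%:M.
Proof. by rewrite -!mulmxA (mulmxA A^T) (eqP (O13P A)) mink_mx_sq. Qed.

Lemma O13_mulmxV (A : O13) : A *m (mink_mx *m A^T *m mink_mx) = 1%:M.
Proof. exact: mulmx1C (O13_mulVmx A). Qed.

Lemma O13_inv_subproof (A : O13) :
  (mink_mx *m A^T *m mink_mx)^T *m mink_mx *m (mink_mx *m A^T *m mink_mx)
    == mink_mx.
Proof.
move: (O13_mulmxV A); move: (mink_mx *m A^T *m mink_mx) => B AB.
apply/eqP; rewrite -[in LHS](eqP (O13P A)) !mulmxA -trmx_mul AB trmx1 mul1mx.
by rewrite -mulmxA AB mulmx1.
Qed.

Definition O13_one := MkO13 O13_one_subproof.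
Definition O13_mul A B := MkO13 (O13_mul_subproof A B).
Definition O13_inv A := MkO13 (O13_inv_subproof A).

Lemma O13_mulA : associative O13_mul.
Proof. by move=> A B C; apply: val_inj; rewrite /= mulmxA. Qed.
Lemma O13_mul1 : left_id O13_one O13_mul.
Proof. by move=> A; apply: val_inj; rewrite /= mul1mx. Qed.
Lemma O13_mulr1 : right_id O13_one O13_mul.
Proof. by move=> A; apply: val_inj; rewrite /= mulmx1. Qed.
Lemma O13_mulV : left_inverse O13_one O13_inv O13_mul.
Proof. by move=> A; apply: val_inj; exact: O13_mulVmx. Qed.
Lemma O13_mulrV : right_inverse O13_one O13_inv O13_mul.
Proof. by move=> A; apply: val_inj; exact: O13_mulmxV. Qed.

HB.instance Definition _ := isGroup.Build O13
  O13_mulA O13_mul1 O13_mulr1 O13_mulV O13_mulrV.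

Lemma O13_valM (A B : O13) : (A * B)%g = A *m B :> 'M_4.
Proof. by []. Qed.

Lemma O13_opp1_subproof :
  (- 1%:M : 'M[R]_4)^T *m mink_mx *m (- 1%:M) == mink_mx.
Proof. by rewrite [(- _)^T]linearN /= trmx1 mulmxN mulNmx mul1mx mulNmx mulmx1 opprK. Qed.

Definition O13_opp1 := MkO13 O13_opp1_subproof.

(** For [mink v v = 1] this is the reflection [r_v]. *)
Definition refl_mx (v : 'cV[R]_4) : 'M[R]_4 :=
  1%:M - 2 *: (v *m (v^T *m mink_mx)).

Lemma refl_mxE v x : refl_mx v *m x = x - (2 * mink v x) *: v.
Proof.
rewrite mulmxBl mul1mx -scalemxAl -(mulmxA v) -scalerA; congr (_ - _ *: _).
by rewrite [_ *m x]mx11_scalar mul_mx_scalar.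
Qed.

Lemma refl_mx_unit v : mink v v = 1 -> refl_mx v *m v = - v.
Proof.
move=> v1; rewrite refl_mxE v1 mulr1 scaler_nat mulr2n opprD addrA subrr.
by rewrite add0r.
Qed.

Lemma refl_mx_orth v x : mink v x = 0 -> refl_mx v *m x = x.
Proof. by move=> vx; rewrite refl_mxE vx mulr0 scale0r subr0. Qed.

Lemma minkDl x y z : mink (x + y) z = mink x z + mink y z.
Proof. by rewrite /mink linearD !mulmxDl mxE. Qed.

Lemma minkZl a x y : mink (a *: x) y = a * mink x y.
Proof. by rewrite /mink linearZ -!scalemxAl mxE. Qed.

Lemma minkC x y : mink x y = mink y x.
Proof.
by rewrite !minkE mulrC; congr (_ + _); apply: eq_bigr => k _; rewrite mulrC.
Qed.

Lemma mink_eq (A B : 'M[R]_4) :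
  (forall x y, mink (A *m x) (B *m y) = mink x y) ->
  A^T *m mink_mx *m B == mink_mx.
Proof.
move=> AB; apply/eqP/matrixP=> i j.
have entry (M : 'M[R]_4) :
    ((delta_mx i 0 : 'cV_4)^T *m M *m (delta_mx j 0 : 'cV_4)) 0 0 = M i j.
  by rewrite trmx_delta -rowE -colE !mxE.
rewrite -entry -[RHS]entry -[RHS](AB (delta_mx i 0) (delta_mx j 0)).
by rewrite /mink trmx_mul !mulmxA.
Qed.

Lemma refl_mx_O13 v : mink v v = 1 ->
  (refl_mx v)^T *m mink_mx *m refl_mx v == mink_mx.
Proof.
move=> v1; apply: mink_eq => x y; rewrite !refl_mxE -!scaleNr.
rewrite minkDl minkZl ![mink _ (y + _)]minkC !minkDl !minkZl.
rewrite !(minkC _ v) v1 (minkC y x); ring.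
Qed.

Definition refl_O13 v (v1 : mink v v = 1) : O13 := MkO13 (refl_mx_O13 v1).

Lemma mx_ext (A B : 'M[R]_4) :
  (forall x : 'cV_4, A *m x = B *m x) -> A = B.
Proof.
move=> AB; apply/matrixP=> i j.
by have /colP/(_ i) := AB (delta_mx j 0); rewrite -!colE !mxE.
Qed.

Lemma refl_O13_sq v (v1 : mink v v = 1) :
  (refl_O13 v1 * refl_O13 v1 = 1)%g.
Proof.
apply/val_inj/mx_ext => x /=; rewrite -mulmxA !refl_mxE mul1mx -!scaleNr.
rewrite (minkC v (_ + _)) minkDl minkZl v1 (minkC x v) -addrA -scalerDl.
by rewrite [X in X *: v](_ : _ = 0) ?scale0r ?addr0 //; ring.
Qed.

Lemma refl_O13_com v w (v1 : mink v v = 1) (w1 : mink w w = 1) :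
  mink v w = 0 ->
  (refl_O13 v1 * refl_O13 w1 = refl_O13 w1 * refl_O13 v1)%g.
Proof.
move=> vw; apply/val_inj/mx_ext => x /=; rewrite -!mulmxA !refl_mxE -!scaleNr.
rewrite ![mink _ (x + _)]minkC !minkDl !minkZl vw (minkC w v) vw.
by rewrite !mulr0 !addr0 !(minkC x) addrAC.
Qed.

Lemma O13_opp1_sq : (O13_opp1 * O13_opp1 = 1)%g.
Proof. by apply/val_inj; rewrite /= mulNmx mul1mx opprK. Qed.

Lemma O13_opp1_com A : (O13_opp1 * A = A * O13_opp1)%g.
Proof. by apply/val_inj; rewrite /= mulNmx mul1mx mulmxN mulmx1. Qed.

End Minkowski.

(** * The group and the representation *)

(** The signs [+1] and [-1] are encoded by [true] and [false], the index [k]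
  in [{1, 2, 3}] by the ordinal [k - 1], so that [e_k] is indexed by
  [lift ord0 k]. *)
Notation sign3 := {ffun 'I_3 -> bool}.

Inductive gen22 := P22 of sign3 | M22 of sign3 | L22 of 'I_3 & bool.

Definition gen22_code (g : gen22) : sign3 + sign3 + 'I_3 * bool :=
  match g with
  | P22 e => inl (inl e) | M22 e => inl (inr e) | L22 k s => inr (k, s)
  end.
Definition gen22_decode (c : sign3 + sign3 + 'I_3 * bool) : gen22 :=
  match c with
  | inl (inl e) => P22 e | inl (inr e) => M22 e | inr (k, s) => L22 k s
  end.
Lemma gen22_codeK : cancel gen22_code gen22_decode.
Proof. by case. Qed.
HB.instance Definition _ := Finite.copy gen22 (can_type gen22_codeK).

Lemma card_gen22 : #|{: gen22}| = 22%N.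
Proof.
rewrite (bij_eq_card (f := gen22_code)).
  by rewrite !card_sum card_prod card_ffun card_bool !card_ord.
by exists gen22_decode => [|[[]|[]]] //; exact: gen22_codeK.
Qed.

Definition com22 (g h : gen22) : bool :=
  match g, h with
  | P22 e, M22 d | M22 d, P22 e => #|[set k | e k != d k]| <= 1
  | P22 e, L22 k s | M22 e, L22 k s
  | L22 k s, P22 e | L22 k s, M22 e => e k == s
  | _, _ => false
  end%N.

Definition Gamma22 := racg com22.
HB.instance Definition _ := Group.on Gamma22.

Section Rho0.
Variable R : realType.

Definition sgn (s : bool) : R := if s then 1 else -1.

Definition ebase (i : 'I_4) : 'cV[R]_4 := delta_mx i 0.

Definition v_sign (e : sign3) : 'cV[R]_4 :=
  Num.sqrt 2 *: ebase 0 + \sum_(k < 3) sgn (e k) *: ebase (lift ord0 k).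

Definition v_axis (k : 'I_3) (s : bool) : 'cV[R]_4 :=
  ebase 0 + (sgn s * Num.sqrt 2) *: ebase (lift ord0 k).

Lemma v_signE0 e : v_sign e 0 0 = Num.sqrt 2.
Proof.
rewrite !mxE eqxx mulr1 summxE big1 ?addr0 // => k _.
by rewrite !mxE andbT mulr0.
Qed.

Lemma v_signE e k : v_sign e (lift ord0 k) 0 = sgn (e k).
Proof.
rewrite !mxE /= mulr0 add0r summxE (bigD1 k) //= big1 ?addr0.
  by rewrite !mxE !eqxx mulr1.
by move=> i ik; rewrite !mxE (inj_eq lift_inj) eq_sym (negbTE ik) mulr0.
Qed.

Lemma v_axisE0 k s : v_axis k s 0 0 = 1.
Proof. by rewrite !mxE eqxx /= mulr0 addr0. Qed.

Lemma v_axisE k s i :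
  v_axis k s (lift ord0 i) 0 = if i == k then sgn s * Num.sqrt 2 else 0.
Proof.
rewrite !mxE /= (inj_eq lift_inj) andbT add0r.
by case: eqP; rewrite ?mulr1 ?mulr0.
Qed.

Lemma sgn_sq s : sgn s * sgn s = 1.
Proof. by case: s; rewrite /sgn ?mulrNN mulr1. Qed.

Lemma sqrt2_sq : Num.sqrt 2 * Num.sqrt 2 = 2 :> R.
Proof. by rewrite -expr2 sqr_sqrtr. Qed.

Lemma v_sign_unit e : mink (v_sign e) (v_sign e) = 1.
Proof.
rewrite minkE v_signE0 sqrt2_sq.
under eq_bigr do rewrite v_signE sgn_sq.
by rewrite sumr_const card_ord; ring.
Qed.

Lemma v_axis_unit k s : mink (v_axis k s) (v_axis k s) = 1.
Proof.
rewrite minkE v_axisE0 (bigD1 k) //= big1 => [|i ik].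
  rewrite v_axisE eqxx mulrACA sgn_sq sqrt2_sq; ring.
by rewrite v_axisE (negbTE ik) mulr0.
Qed.

Lemma v_sign_axis e k : mink (v_sign e) (v_axis k (e k)) = 0.
Proof.
rewrite minkE v_axisE0 v_signE0 (bigD1 k) //= big1 => [|i ik].
  by rewrite v_axisE v_signE eqxx mulrA sgn_sq; ring.
by rewrite v_axisE (negbTE ik) mulr0.
Qed.

Definition rho0_gen (g : gen22) : O13 R :=
  match g with
  | P22 _ => O13_opp1 R
  | M22 e => refl_O13 (v_sign_unit e)
  | L22 k s => refl_O13 (v_axis_unit k s)
  end.

Lemma rho0_gen_sq g : (rho0_gen g * rho0_gen g = 1)%g.
Proof.
by case: g => [e|e|k s]; [exact: O13_opp1_sq | exact: refl_O13_sq ..].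
Qed.

Lemma rho0_gen_com g h : com22 g h ->
  (rho0_gen g * rho0_gen h = rho0_gen h * rho0_gen g)%g.
Proof.
case: g h => [e|e|k s] [d|d|j t] //= gh; rewrite ?O13_opp1_com //.
- by rewrite -(eqP gh); apply: refl_O13_com; exact: v_sign_axis.
- rewrite -(eqP gh); apply: refl_O13_com.
  by rewrite minkC; exact: v_sign_axis.
Qed.

Definition rho0 : Gamma22 -> O13 R := racg_lift rho0_gen.

HB.instance Definition _ := isMultiplicative.Build Gamma22 (O13 R) rho0
  (racg_liftM rho0_gen_sq rho0_gen_com).

Lemma rho0_coboundary_cocycle tau :
  is_coboundary (fun g : Gamma22 => O13_val (rho0 g)) tau ->
  tau \in is_cocycle (fun g : Gamma22 => O13_val (rho0 g)).
Proof. by apply: coboundary_cocycle => g h; rewrite gmulfM. Qed.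

Lemma rho0_genE g : rho0 (racg_gen com22 g) = rho0_gen g.
Proof. exact: racg_lift_gen rho0_gen_sq rho0_gen_com g. Qed.

End Rho0.

(* Main.v *)
(** Since [rho0 p_e = -1], the relation between [p_e] and any generator [g]
  commuting with it determines [tau g] from [tau p_e]; as every generator
  commutes with some [p_e], a cocycle [tau] is determined by the eight vectors
  [tau p_e]. For adjacent vertices [e], [e'] of the cube, [tau p_e - tau p_e']
  is orthogonal to [v_e], [v_e'] and to the two [v_(k,s)] shared by [e] and
  [e'], hence is a multiple of [v_e + v_e']. Comparing coordinates around the
  squares of the cube, this multiple is [c * chi e] with [c] constant and [chi]
  the product of the signs. So [tau p_e - c * chi e * v_e] does not depend on
  [e] and is the value at [p_e] of a coboundary. Conversely
  [p_e, m_e |-> chi e * v_e], [l_(k,s) |-> 0] extends to a cocycle that is not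
  a coboundary. *)

Require Import Defs.
From mathcomp Require Import all_boot all_order all_algebra.
From mathcomp Require Import all_classical all_reals.
From mathcomp Require Import ring lra.

Set Implicit Arguments.
Unset Strict Implicit.
Unset Printing Implicit Defensive.
Import Order.TTheory GRing.Theory Num.Theory.
Local Open Scope ring_scope.
Local Open Scope quotient_scope.

(** * Elementary facts about cocycles *)

Section Cocycles.
Variables (F : fieldType) (G : groupType) (n : nat) (rho : G -> 'M[F]_n).

Lemma cocycleM (tau : Z1 rho) g h :
  tau (g * h)%g = rho g *m tau h + tau g.
Proof. by have /asboolP := Z1P tau; apply. Qed.

Lemma cocycle1 (tau : Z1 rho) : rho 1%g = 1%:M -> tau 1%g = 0.
Proof.
move=> rho1; have := cocycleM tau 1%g 1%g; rewrite mulg1 rho1 mul1mx => /eqP.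
by rewrite -subr_eq subrr => /eqP.
Qed.

End Cocycles.

(** * Cocycles on a right-angled Coxeter group, built from their values on generators *)

Section RacgCocycle.
Variables (S : choiceType) (com : rel S) (F : fieldType) (n : nat).
Variable rho : racg com -> 'M[F]_n.
Hypothesis rho1 : rho 1%g = 1%:M.
Hypothesis rhoM : forall g h, rho (g * h)%g = rho g *m rho h.

Lemma cocycle_gen_eq0 (tau : Z1 rho) :
  (forall s, tau (racg_gen com s) = 0) -> forall x, tau x = 0.
Proof.
move=> tau0; elim/racg_ind => [|s x ih]; first by rewrite cocycle1.
by rewrite cocycleM ih tau0 mulmx0 addr0.
Qed.

Variable f : S -> 'cV[F]_n.

(** The value that the cocycle rule forces on a product of generators. *)
Definition word_cocycle : seq S -> 'cV[F]_n :=
  foldr (fun s x => rho (racg_gen com s) *m x + f s) 0.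

Lemma word_cocycle_cat w1 w2 : word_cocycle (w1 ++ w2) =
  rho (\pi_(racg com) w1) *m word_cocycle w2 + word_cocycle w1.
Proof.
elim: w1 => [|s w ih] /=; first by rewrite -/(racg_one com) rho1 mul1mx addr0.
rewrite ih mulmxDr mulmxA -rhoM addrA; congr (rho _ *m _ + _ + _).
exact: racg_piM.
Qed.

Hypothesis f_sq : forall s, rho (racg_gen com s) *m f s + f s = 0.
Hypothesis f_com : forall s t, com s t ->
  rho (racg_gen com s) *m f t + f s = rho (racg_gen com t) *m f s + f t.

(** By [word_cocycle_cat] it suffices to compare the two sides of each defining relation, and there
    [f_sq] and [f_com] apply. *)
Lemma word_cocycle_rel w1 w2 :
  racg_rel com w1 w2 -> word_cocycle w1 = word_cocycle w2.
Proof.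
elim=> {w1 w2} [v w s|v w s t st|w|w1 w2 _ h|w1 w2 w3 _ h1 _ h2] //.
- rewrite !word_cocycle_cat /= mulmx0 add0r f_sq addr0.
  by rewrite (racg_pi (racg_sq com [::] [::] s)) rho1 mul1mx.
- rewrite !word_cocycle_cat /= !mulmx0 !add0r (f_com st).
  by rewrite (racg_pi (racg_com [::] [::] st)).
- by rewrite h1.
Qed.

Lemma racg_cocycle_ext :
  exists tau : Z1 rho, forall s, tau (racg_gen com s) = f s.
Proof.
have tau_pi w : word_cocycle (repr (\pi_(racg com) w)) = word_cocycle w.
  by apply: word_cocycle_rel; exact: racg_repr.
have tauP : (fun x => word_cocycle (repr x)) \in is_cocycle rho.
  by apply/asboolP => g h; rewrite tau_pi word_cocycle_cat reprK.
by exists (MkZ1 tauP) => s /=; rewrite tau_pi /= mulmx0 add0r.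
Qed.

End RacgCocycle.

(** * The cube of sign vectors and its edges *)

Section Flip.

Definition flip (e : sign3) (k : 'I_3) : sign3 :=
  [ffun j => if j == k then ~~ e j else e j].

Lemma flipE e k : flip e k k = ~~ e k.
Proof. by rewrite ffunE eqxx. Qed.

Lemma flipNE e k j : j != k -> flip e k j = e j.
Proof. by rewrite ffunE => /negbTE->. Qed.

Lemma flipC e i k : flip (flip e i) k = flip (flip e k) i.
Proof. by apply/ffunP => j; rewrite !ffunE; case: eqP; case: eqP. Qed.

Lemma flipK e k : flip (flip e k) k = e.
Proof. by apply/ffunP => j; rewrite !ffunE; case: eqP; rewrite ?negbK. Qed.

Lemma dist_le1P (e d : sign3) : (#|[set k | e k != d k]| <= 1)%N ->
  d = e \/ exists k, d = flip e k.
Proof.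
move=> /card_le1_eqP ed; case: (eqVneq d e) => [|de]; first by left.
have [k ek] : exists k, e k != d k.
  apply/existsP; apply: contra_neqT de; rewrite negb_exists => /forallP h.
  by apply/ffunP => k; apply/esym/eqP; rewrite -[_ == _]negbK h.
right; exists k; apply/ffunP => j; rewrite ffunE; case: eqP => [->|/eqP jk].
  by move: ek; case: (e k) (d k) => [] [].
apply: contra_neq_eq jk => jk; apply: ed; rewrite inE // eq_sym //.
Qed.

Lemma com22_PM e : com22 (P22 e) (M22 e).
Proof.
rewrite /= (_ : [set k | _] = finset.set0) ?cards0 //.
by apply/finset.setP => k; rewrite !inE eqxx.
Qed.

Lemma com22_PM_flip e k : com22 (P22 e) (M22 (flip e k)).
Proof.
apply: (@leq_trans #|[set k]|); last by rewrite cards1.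
apply: subset_leq_card; apply/fintype.subsetP => j.
by rewrite !inE; apply: contraNT => jk; rewrite flipNE.
Qed.

(** Connectedness of the cube, by induction on the Hamming distance between [e] and [d]. *)
Lemma flip_const (T : Type) (f : sign3 -> T) :
  (forall e k, f (flip e k) = f e) -> forall e d, f e = f d.
Proof.
move=> f_flip e d.
have [m] := ubnP #|[set k | e k != d k]|; elim: m e => // m ih e.
rewrite ltnS => em; case: (set_0Vmem [set k | e k != d k]) => [e0|[k]].
  congr f; apply/ffunP => k; apply/eqP; rewrite -[_ == _]negbK.
  by apply/negP => kk; have := finset.in_set0 k; rewrite -e0 inE kk.
rewrite inE => ek; rewrite -(f_flip e k); apply: ih; apply: leq_trans em.
apply: proper_card; apply/fintype.properP; split.
  apply/fintype.subsetP => j; rewrite !inE ffunE.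
  by case: (eqVneq j k) => // ->.
exists k; rewrite inE // flipE negbK.
by move: ek; case: (e k) (d k) => [] [].
Qed.

End Flip.

(** * The explicit cocycle, and constraints on arbitrary ones *)

Section Rho0Cocycles.
Variable R : realType.
Notation rho := (fun g : Gamma22 => O13_val (rho0 R g)).
Notation gen := (racg_gen com22).
Notation s2 := (Num.sqrt 2 : R).
Notation v_sign := (v_sign R).
Notation v_axis := (v_axis R).

Lemma rho0_1 : rho 1%g = 1%:M.
Proof.
by rewrite /rho0 racg_lift1 //; [exact: rho0_gen_sq | exact: rho0_gen_com].
Qed.

Lemma rho0_M g h : rho (g * h)%g = rho g *m rho h.
Proof. by rewrite /= gmulfM. Qed.

Lemma sgnN b : sgn R (~~ b) = - sgn R b.
Proof. by case: b; rewrite /= ?opprK. Qed.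

Definition chi (e : sign3) : R := \prod_k sgn R (e k).

Lemma chi_flip e k : chi (flip e k) = - chi e.
Proof.
rewrite /chi (bigD1 k) //= [in RHS](bigD1 k) //= flipE sgnN mulNr.
by congr (- (_ * _)); apply: eq_bigr => j jk; rewrite flipNE.
Qed.

Lemma chi_sq e : chi e * chi e = 1.
Proof. by rewrite -big_split /= big1 // => k _; rewrite sgn_sq. Qed.

Lemma s2_neq0 : s2 != 0.
Proof. by rewrite sqrtr_eq0 -ltNge ltr0n. Qed.

Lemma sgn_neq0 b : sgn R b != 0.
Proof. by case: b; rewrite /= ?oppr_eq0 oner_eq0. Qed.

Lemma cV4P (x y : 'cV[R]_4) : x 0 0 = y 0 0 ->
  (forall k : 'I_3, x (lift ord0 k) 0 = y (lift ord0 k) 0) -> x = y.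
Proof.
move=> xy0 xyk; apply/colP => i; case: (unliftP ord0 i) => [k|] -> //.
Qed.

Lemma mink_v_axis k s x :
  mink (v_axis k s) x = - x 0 0 + sgn R s * s2 * x (lift ord0 k) 0.
Proof.
rewrite minkE v_axisE0 mul1r (bigD1 k) //= big1 => [|i ik].
  by rewrite v_axisE eqxx addr0.
by rewrite v_axisE (negbTE ik) mul0r.
Qed.

Lemma mink_v_sign_flip e k x :
  mink (v_sign e) x - mink (v_sign (flip e k)) x =
  2 * sgn R (e k) * x (lift ord0 k) 0.
Proof.
rewrite !minkE !v_signE0 opprD addrACA subrr add0r -sumrB.
rewrite (bigD1 k) //= big1 => [|i ik].
  by rewrite !v_signE flipE sgnN; ring.
by rewrite !v_signE flipNE // subrr.
Qed.

Lemma mink_v_sign_adjacent e k : mink (v_sign (flip e k)) (v_sign e) = -1.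
Proof.
have := mink_v_sign_flip e k (v_sign e); rewrite v_sign_unit v_signE -mulrA.
by rewrite sgn_sq => h; lra.
Qed.

Definition tau0_gen (g : gen22) : 'cV[R]_4 :=
  match g with
  | P22 e | M22 e => chi e *: v_sign e
  | L22 _ _ => 0
  end.

Lemma refl_v_axis (e : sign3) k (x : R) :
  refl_mx (v_axis k (e k)) *m (x *: v_sign e) = x *: v_sign e.
Proof. by rewrite refl_mx_orth // minkC minkZl v_sign_axis mulr0. Qed.

(** For [d = e] both sides vanish. For adjacent [d] the reflection sends [v_sign e] to
    [v_sign e + 2 *: v_sign d], and the sign change of [chi] makes both sides equal to
    [chi e *: (v_sign e + v_sign d)]. *)
Lemma tau0_gen_pm e d : com22 (P22 e) (M22 d) ->
  rho (gen (P22 e)) *m tau0_gen (M22 d) + tau0_gen (P22 e) =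
  rho (gen (M22 d)) *m tau0_gen (P22 e) + tau0_gen (M22 d).
Proof.
rewrite /= !rho0_genE /= mulNmx mul1mx -scalemxAr refl_mxE.
move=> /dist_le1P [->|[k ->]].
  by rewrite v_sign_unit; apply/colP => i; rewrite !mxE; ring.
by rewrite mink_v_sign_adjacent chi_flip; apply/colP => i; rewrite !mxE; ring.
Qed.

Lemma tau0_exists :
  exists tau : Z1 rho, forall g, tau (gen g) = tau0_gen g.
Proof.
apply: racg_cocycle_ext => [||s|s t].
- exact: rho0_1.
- exact: rho0_M.
- rewrite rho0_genE; case: s => [e|e|k s] /=.
  + by rewrite mulNmx mul1mx addNr.
  + by rewrite -scalemxAr refl_mx_unit ?v_sign_unit // scalerN addNr.
  + by rewrite mulmx0 addr0.
(* Relations with some [L22] hold because its reflection fixes the orthogonal vector [v_sign e]. *)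
- case: s t => [e|e|k s] [d|d|j t] //=;
    try by move=> /eqP <-; rewrite !rho0_genE /= mulmx0 add0r refl_v_axis addr0.
  + exact: tau0_gen_pm.
  + by move=> ed; apply/esym/tau0_gen_pm.
Qed.

(** Expand [tau] on both orders of the commuting product, using that [P22 e] acts as minus the
    identity. *)
Lemma cocycle_comP (tau : Z1 rho) e g : com22 (P22 e) g ->
  2 *: tau (gen g) = tau (gen (P22 e)) - rho (gen g) *m tau (gen (P22 e)).
Proof.
have half (A t p : 'cV[R]_4) : A + t = - t + p -> 2 *: t = p - A.
  by move=> /colP h; apply/colP => i; have := h i; rewrite !mxE => hi; lra.
move=> eg; apply: half; have := cocycleM tau (gen (P22 e)) (gen g).
have -> : ((gen (P22 e) : Gamma22) * gen g = (gen g : Gamma22) * gen (P22 e))%g.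
  exact: racg_gen_com.
by rewrite cocycleM /= (rho0_genE _ (P22 e)) /= mulNmx mul1mx.
Qed.

Lemma gen22_comP g : exists e, com22 (P22 e) g \/ exists d, g = P22 d.
Proof.
case: g => [e|e|k s].
- by exists e; right; exists e.
- by exists e; left; exact: com22_PM.
- by exists [ffun=> s]; left; rewrite /= ffunE.
Qed.

Lemma cocycle_P_eq0 (tau : Z1 rho) :
  (forall e, tau (gen (P22 e)) = 0) -> forall x, tau x = 0.
Proof.
move=> tauP; apply: (cocycle_gen_eq0 rho0_1) => g.
have [e [eg|[d ->]]] := gen22_comP g; last exact: tauP.
have := cocycle_comP tau eg; rewrite tauP mulmx0 subr0 => /eqP.
by rewrite scaler_eq0 pnatr_eq0 => /eqP.
Qed.

(** The two formulas for [2 *: tau (gen g)] show that the reflection moves both vectors by the same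
    multiple of [v]. *)
Lemma cocycle_refl_mink (tau : Z1 rho) e d g v :
  mink v v = 1 -> rho (gen g) = refl_mx v ->
  com22 (P22 e) g -> com22 (P22 d) g ->
  mink v (tau (gen (P22 e)) - tau (gen (P22 d))) = 0.
Proof.
move=> v1 gv eg dg.
have reflB p : p - refl_mx v *m p = (2 * mink v p) *: v.
  by rewrite refl_mxE opprB addrC subrK.
have := cocycle_comP tau eg; rewrite (cocycle_comP tau dg) gv !reflB.
move=> /(congr1 (fun x => mink x v)); rewrite !minkZl v1 !mulr1 => h.
rewrite minkC minkDl -scaleN1r minkZl !(minkC _ v); lra.
Qed.

(** * Classification of the values of a cocycle on the generators [P22 e] *)

Section Classification.
Variable tau : Z1 rho.
Notation P e := (tau (gen (P22 e))).

(** The coefficient along [v_sign e + v_sign (flip e k)], whose time coordinate is [2 * s2]. *)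
Definition edge e k : R := (P e - P (flip e k)) 0 0 / (2 * s2).

Lemma P_flip e k :
  P e - P (flip e k) = edge e k *: (v_sign e + v_sign (flip e k)).
Proof.
rewrite /edge; set D := P e - _.
have De : mink (v_sign e) D = 0.
  apply: (@cocycle_refl_mink _ _ _ (M22 e)).
  - exact: v_sign_unit.
  - by rewrite /= rho0_genE.
  - exact: com22_PM.
  - by rewrite -{2}(flipK e k); exact: com22_PM_flip.
have Dk : mink (v_sign (flip e k)) D = 0.
  apply: (@cocycle_refl_mink _ _ _ (M22 (flip e k))).
  - exact: v_sign_unit.
  - by rewrite /= rho0_genE.
  - exact: com22_PM_flip.
  - exact: com22_PM.
apply: cV4P => [|j].
  by rewrite [RHS]mxE [X in _ * X]mxE !v_signE0; field; exact: s2_neq0.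
(* Subtracting [Dk] from [De] kills coordinate [k]; for [j != k] the shared axis vector ties
   coordinate [j] to the time coordinate. *)
rewrite [RHS]mxE [X in _ * X]mxE !v_signE; case: (eqVneq j k) => [->|jk].
  rewrite flipE sgnN subrr mulr0.
  have := mink_v_sign_flip e k D; rewrite De Dk subrr => /esym/eqP.
  by rewrite !mulf_eq0 pnatr_eq0 (negbTE (sgn_neq0 _)) => /eqP.
have : mink (v_axis j (e j)) D = 0.
  apply: (@cocycle_refl_mink _ _ _ (L22 j (e j))).
  - exact: v_axis_unit.
  - by rewrite /= rho0_genE.
  - exact: eqxx.
  - by rewrite /= flipNE.
rewrite mink_v_axis flipNE //.
move: (D (lift _ _) _) (D _ _) (sgn_sq R (e j)) => xj x0.
move: (sgn _ _) => s ss h; have -> : x0 = s * s2 * xj by lra.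
transitivity (s * s * xj); [by rewrite ss mul1r | field; exact: s2_neq0].
Qed.

Lemma P_flip_coord e k j : P e (lift ord0 j) 0 - P (flip e k) (lift ord0 j) 0 =
  if j == k then 0 else 2 * edge e k * sgn R (e j).
Proof.
have -> : P e (lift ord0 j) 0 - P (flip e k) (lift ord0 j) 0 =
  (P e - P (flip e k)) (lift ord0 j) 0 by rewrite !mxE.
rewrite P_flip [LHS]mxE [X in _ * X]mxE !v_signE.
case: eqP => [->|/eqP jk]; first by rewrite flipE sgnN subrr mulr0.
by rewrite flipNE //; ring.
Qed.

Lemma P_flip_coord0 e k : P e 0 0 - P (flip e k) 0 0 = 2 * s2 * edge e k.
Proof. by rewrite /edge !mxE; field; exact: s2_neq0. Qed.

(* Compares the [i]-th coordinates around the square spanned by [i] and [k]. *)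
Lemma edge_flipN e i k : i != k -> edge (flip e i) k = - edge e k.
Proof.
move=> ik.
have := P_flip_coord e k i; have := P_flip_coord (flip e k) i i.
have := P_flip_coord e i i; have := P_flip_coord (flip e i) k i.
rewrite (negbTE ik) eqxx flipE sgnN (flipC e k i) => h1 h2 h3 h4.
apply: (mulfI (sgn_neq0 (e i))); lra.
Qed.

(** Summing time coordinates along both paths to the opposite corner of a square gives [edge e i -
    edge e k = edge e k - edge e i]. *)
Lemma edge_eq e i k : edge e i = edge e k.
Proof.
case: (eqVneq i k) => [->//|ik].
have := P_flip_coord0 e k; have := P_flip_coord0 (flip e k) i.
have := P_flip_coord0 e i; have := P_flip_coord0 (flip e i) k.
rewrite (flipC e k i) edge_flipN // edge_flipN; last by rewrite eq_sym.
move=> h1 h2 h3 h4; apply: (mulfI s2_neq0); lra.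
Qed.

Lemma edge_flip e i k : edge (flip e i) k = - edge e k.
Proof.
(* The case [k = i] escapes [edge_flipN], so [edge_eq] first replaces [k] by a direction [j] other
   than [i]. *)
have [j ji] : exists j : 'I_3, i != j.
  by case: (eqVneq i ord0) => [->|h]; [exists ord_max | exists ord0].
by rewrite (edge_eq _ k j) (edge_eq e k j) edge_flipN.
Qed.

(** Both [edge] and [chi] change sign under a flip, so their product is constant on the cube. *)
Lemma edge_chi e k d j : edge e k = edge d j * chi d * chi e.
Proof.
have <- : edge e j * chi e = edge d j * chi d.
  apply: (@flip_const _ (fun e => edge e j * chi e)) => {}e {}k.
  by rewrite edge_flip chi_flip mulrNN.
by rewrite -mulrA chi_sq mulr1; exact: edge_eq.
Qed.

(** The term [- 2 *: v] is the value at every [P22 e] of the coboundary of [v]. *)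
Lemma cocycle_P_form :
  exists c v, forall e, P e = c *: (chi e *: v_sign e) - 2 *: v.
Proof.
pose d : sign3 := [ffun=> true]; pose c := edge d ord0 * chi d.
pose Q e := P e - (c * chi e) *: v_sign e.
have Q_flip e k : Q (flip e k) = Q e.
  have eE : edge e k = c * chi e by exact: edge_chi.
  rewrite /Q chi_flip -(subKr (P e) (P (flip e k))) P_flip eE.
  by apply/colP => i; rewrite !mxE; ring.
exists c, (- 2^-1 *: Q d) => e; rewrite (flip_const Q_flip d e).
by apply/colP => i; rewrite !mxE; field.
Qed.

End Classification.

End Rho0Cocycles.

(** * The class of the explicit cocycle is a basis *)

Theorem proposition6p5 (R : realType) :
  has_dimension (H1 (fun g : Gamma22 => O13_val (rho0 R g))) 1.
Proof.
have [t0 t0E] := tau0_exists R.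
exists (fun _ => \pi t0); split=> [c|x].
  rewrite big_ord1 => c0 i; rewrite (ord1 i).
  have : \pi_(H1 _) (c ord0 *: t0) = \pi_(H1 _) 0.
    by rewrite -H1_piZ; apply: (eq_trans c0); rewrite raddf0.
  move=> /eqP; rewrite H1_eqE subr0 => /asboolP [v hv].
  have vE e : c ord0 *: (chi R e *: v_sign R e) = - v - v.
    have := hv (racg_gen com22 (P22 e)).
    by rewrite [LHS]/= fctE t0E rho0_genE /= mulNmx mul1mx.
  pose e : sign3 := [ffun=> true].
  (* The right side is independent of [d], whereas [chi] changes sign under a flip; this forces the
     coefficient to vanish. *)
  have vE0 d : c ord0 * (chi R d * Num.sqrt 2) = (- v - v) 0 0.
    by rewrite -(vE d) [RHS]mxE [X in _ = _ * X]mxE v_signE0.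
  have := vE0 e; rewrite -(vE0 (flip e ord0)) chi_flip !mulrA.
  move=> /(mulIf (s2_neq0 R)).
  rewrite mulrN => /eqP; rewrite -addr_eq0 -mulr2n mulrn_eq0 /= mulf_eq0.
  case/orP => /eqP // chi0; have /eqP := chi_sq R e.
  by rewrite chi0 mul0r eq_sym oner_eq0.
elim/quotW: x => t.
have [c [v tE]] := cocycle_P_form t.
exists (fun=> c); rewrite big_ord1.
apply: (eq_trans _ (esym (H1_piZ _ _))); apply/eqP; rewrite H1_eqE.
apply/asboolP; exists v => g.
pose dv (g : Gamma22) := O13_val (rho0 R g) *m v - v.
have dvP : dv \in is_cocycle (fun g : Gamma22 => O13_val (rho0 R g)).
  by apply: rho0_coboundary_cocycle; exists v.
apply/eqP; rewrite -subr_eq0; apply/eqP.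
(* Equality with the coboundary of [v] need only be checked at each [P22 e], where [tE] gives it. *)
apply: (cocycle_P_eq0 (tau := t - c *: t0 - MkZ1 dvP)) => e.
set p := racg_gen com22 (P22 e).
rewrite -[LHS]/(t p - c *: t0 p - (O13_val (rho0 R p) *m v - v)).
rewrite tE t0E rho0_genE /= mulNmx mul1mx.
by apply/colP => i; rewrite !mxE; ring.
Qed.
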